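(* Let $\mathcal N=\{1,\dots,n\}$ be a universe of products with prices $p_1\ge\cdots\ge p_n\ge0$ and preference weights $v_1,\dots,v_n>0$, let $T\ge1$, and let $\ell_i\in\{0,1,\dots,T\}$ for $i\in\mathcal N$. Let $\mathsf{OPT}^{APV}$ be the optimal value of $$\max_{S_1,\dots,S_T\subseteq\mathcal N}\ \sum_{t=1}^TR(S_t)\quad\text{s.t.}\quad \sum_{t=1}^T\mathbf 1(i\in S_t)\ge\ell_i\ \ \forall i\in\mathcal N, \qquad\text{(APV)}$$ and let $\mathsf{OPT}^{LP}$ be the optimal value of the linear program in variables $\boldsymbol\alpha=(\alpha_i^t)_{0\le i\le n,\,1\le t\le T}$ $$\begin{aligned}\max_{\boldsymbol\alpha}\ & \sum_{i=1}^np_i\sum_{t=1}^T\alpha_i^t\\ \text{s.t. } & \sum_{i=0}^n\alpha_i^t=1 && \forall t\in\{1,\dots,T\},\\ & \frac{\alpha_i^t}{v_i}=\alpha_0^t && \forall i\in\mathcal N,\ \forall t\in\{1,\dots,\ell_i\},\\ & 0\le\frac{\alpha_i^t}{v_i}\le\alpha_0^t && \forall i\in\mathcal N,\ \forall t\in\{\ell_i+1,\dots,T\}.\end{aligned}\qquad\text{(LP)}$$ Then $\mathsf{OPT}^{LP}=\mathsf{OPT}^{APV}$. Moreover, given an optimal solution $\boldsymbol\alpha$ of (LP), an optimal solution $S_1^*,\dots,S_T^*$ of (APV) is obtained by taking $S_t^*=\{i\in\mathcal N:\alpha_i^t>0\}$ for all $t\in\{1,\dots,T\}$.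
   Context: For an assortment $S\subseteq\mathcal N$, the MNL expected revenue is $R(S)=\frac{\sum_{i\in S}p_iv_i}{1+\sum_{i\in S}v_i}$. *)

(* Defs.v *)
From HB Require Import structures.
From mathcomp Require Import all_boot all_order all_algebra.
From mathcomp Require Import classical_sets reals.

Set Implicit Arguments.
Unset Strict Implicit.
Unset Printing Implicit Defensive.

Import Order.TTheory GRing.Theory Num.Theory.

Local Open Scope ring_scope.

Definition is_optimal (R : realType) (X : Type) (F : set X) (f : X -> R)
    (x : X) : Prop :=
  F x /\ forall y, F y -> f y <= f x.

(* [sup] returns a default value on empty or unbounded sets, so an equation
   between optimal values is meaningful only when maximizers exist. *)
Definition opt_value (R : realType) (X : Type) (F : set X) (f : X -> R) : R :=
  sup (image F f).

(* Products and periods are numbered from 0: [i : 'I_n] is product i + 1 and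
   [t : 'I_T] is period t + 1. *)

Definition mnl_revenue (R : realType) (n : nat) (p v : 'I_n -> R)
    (S : {set 'I_n}) : R :=
  (\sum_(i in S) p i * v i) / (1 + \sum_(i in S) v i).

Definition apv_feasible (n T : nat) (ell : 'I_n -> nat)
    (S : {ffun 'I_T -> {set 'I_n}}) : Prop :=
  forall i : 'I_n, (ell i <= \sum_(t < T) (i \in S t))%N.

Definition apv_objective (R : realType) (n T : nat) (p v : 'I_n -> R)
    (S : {ffun 'I_T -> {set 'I_n}}) : R :=
  \sum_(t < T) mnl_revenue p v (S t).

(* Row [ord0] of [alpha : 'M_(n.+1, T)] is the no-purchase option, and row
   [lift ord0 i] is product [i]. *)

Definition lp_feasible (R : realType) (n T : nat) (v : 'I_n -> R)
    (ell : 'I_n -> nat) (alpha : 'M[R]_(n.+1, T)) : Prop :=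
  [/\ forall t : 'I_T, \sum_(i < n.+1) alpha i t = 1,
      forall (i : 'I_n) (t : 'I_T), (t < ell i)%N ->
        alpha (lift ord0 i) t / v i = alpha ord0 t
    & forall (i : 'I_n) (t : 'I_T), (ell i <= t)%N ->
        0 <= alpha (lift ord0 i) t / v i <= alpha ord0 t].

Definition lp_objective (R : realType) (n T : nat) (p : 'I_n -> R)
    (alpha : 'M[R]_(n.+1, T)) : R :=
  \sum_(i < n) p i * \sum_(t < T) alpha (lift ord0 i) t.

Definition lp_support (R : realType) (n T : nat) (alpha : 'M[R]_(n.+1, T)) :
    {ffun 'I_T -> {set 'I_n}} :=
  [ffun t => [set i : 'I_n | 0 < alpha (lift ord0 i) t]].

(* Main.v *)
Require Import Defs.
From HB Require Import structures.
From mathcomp Require Import all_boot all_order all_algebra.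
From mathcomp Require Import classical_sets reals.
From mathcomp Require Import ring lra zify.

(** Both programs split into one problem per period.  Write M_t for the set
of products i with t < ell i; these sets shrink as t grows, and G_t denotes
the largest revenue of an assortment that contains M_t.  Both optimal values
equal the sum of the G_t.

The comparisons of revenues below rest on one linearization: z is at most
R(S) exactly when the sum over S of (p_i - z) v_i is at least z
([le_mnl_revenue]).

Assortments S_t containing M_t satisfy the minimum-display constraints, so
the optimal value of (APV) is at least the sum of the G_t.  For the converse
an arbitrary feasible family is replaced by a nested one that earns no less
([apv_nested_dominates]): adding to an assortment a product priced at least
at its revenue does not hurt ([mnl_revenue_add]), and once no such product is
left, replacing two assortments by their union and their intersection does
not hurt either ([mnl_revenue_uncross]).  A nested family that displays
product i at least ell i times displays it in the first ell i periods, so its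
t-th assortment contains M_t ([nested_required]).

In (LP) a column with objective value z rounds to M_t together with all
products priced at least z, and the revenue of this set is at least z
([threshold_revenue]); hence each column is worth at most G_t, and the columns
built from the best assortments attain this bound.  In an optimal solution
every column is worth exactly G_t, so the rounding step is tight term by term.
This forces every non-required product of price below z to have value 0, and
then the support of the column earns at least z as well
([support_revenue]). *)
Set Implicit Arguments.
Unset Strict Implicit.
Unset Printing Implicit Defensive.

Import Order.TTheory GRing.Theory Num.Theory.

Local Open Scope ring_scope.

(** * Revenue of one assortment *)

Definition total_weight (R : realType) (n : nat) (v : 'I_n -> R)
    (S : {set 'I_n}) : R := 1 + \sum_(i in S) v i.

(** The numerator of R(S) - z once the no-purchase term - z is left out;
being additive in S, it turns comparisons of ratios into comparisons of
sums. *)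
Definition surplus (R : realType) (n : nat) (p v : 'I_n -> R) (z : R)
    (S : {set 'I_n}) : R := \sum_(i in S) (p i - z) * v i.

Lemma total_weight_gt0 (R : realType) (n : nat) (v : 'I_n -> R)
    (S : {set 'I_n}) :
  (forall i, 0 < v i) -> 0 < total_weight v S.
Proof.
by move=> v_gt0; rewrite ltr_pwDl ?ltr01 // sumr_ge0 // => i _; apply: ltW.
Qed.

Lemma le_total_weight (R : realType) (n : nat) (v : 'I_n -> R)
    (A B : {set 'I_n}) :
  (forall i, 0 < v i) -> A \subset B -> total_weight v A <= total_weight v B.
Proof.
move=> v_gt0 /finset.setIidPr AB; rewrite /total_weight lerD2l.
rewrite [leRHS](big_setID A) /= AB.
by rewrite lerDl sumr_ge0 // => i _; apply: ltW.
Qed.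

Lemma mnl_revenueB (R : realType) (n : nat) (p v : 'I_n -> R) (z : R)
    (S : {set 'I_n}) :
  (forall i, 0 < v i) ->
  mnl_revenue p v S - z = (surplus p v z S - z) / total_weight v S.
Proof.
move=> v_gt0; have W0 := lt0r_neq0 (total_weight_gt0 S v_gt0).
have -> : surplus p v z S = \sum_(i in S) p i * v i - z * \sum_(i in S) v i.
  by rewrite mulr_sumr -sumrB; apply: eq_bigr => i _; rewrite mulrBl.
rewrite /mnl_revenue -/(total_weight v S).
have -> : \sum_(i in S) v i = total_weight v S - 1.
  by rewrite /total_weight addrC addKr.
by field.
Qed.

Lemma le_mnl_revenue (R : realType) (n : nat) (p v : 'I_n -> R) (z : R)
    (S : {set 'I_n}) :
  (forall i, 0 < v i) -> (z <= mnl_revenue p v S) = (z <= surplus p v z S).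
Proof.
move=> v_gt0; rewrite -subr_ge0 mnl_revenueB //.
by rewrite pmulr_lge0 ?invr_gt0 ?total_weight_gt0 // subr_ge0.
Qed.

Lemma surplus_revenue (R : realType) (n : nat) (p v : 'I_n -> R)
    (S : {set 'I_n}) :
  (forall i, 0 < v i) ->
  surplus p v (mnl_revenue p v S) S = mnl_revenue p v S.
Proof.
move=> v_gt0; have := mnl_revenueB p (mnl_revenue p v S) S v_gt0.
move/eqP; rewrite subrr eq_sym mulf_eq0 invr_eq0.
rewrite (gt_eqF (total_weight_gt0 S v_gt0)) orbF subr_eq0 => /eqP //.
Qed.

Lemma mnl_revenue_add (R : realType) (n : nat) (p v : 'I_n -> R)
    (S : {set 'I_n}) (i : 'I_n) :
  (forall i, 0 < v i) -> i \notin S -> mnl_revenue p v S <= p i ->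
  mnl_revenue p v S <= mnl_revenue p v (i |: S).
Proof.
move=> v_gt0 iS le_p; rewrite le_mnl_revenue // /surplus big_setU1 //=.
rewrite -/(surplus _ _ _ _) surplus_revenue //.
by rewrite lerDr mulr_ge0 ?subr_ge0 // ltW.
Qed.

(** Let R(A) <= R(B) and D = B :\: A.  Passing from A to A :|: B adds D, and
passing from B to A :&: B removes D.  All of D is priced at most R(A), so it
dilutes both revenues.  Adding it to A costs no more than removing it from B
gains: its prices lie closer to R(A) than to R(B), and its effect is divided
by the larger of the two total weights. *)
Lemma mnl_revenue_uncross (R : realType) (n : nat) (p v : 'I_n -> R)
    (A B : {set 'I_n}) :
  (forall i, 0 < v i) ->
  (forall i, i \notin A -> p i <= mnl_revenue p v A) ->
  (forall i, i \notin B -> p i <= mnl_revenue p v B) ->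
  mnl_revenue p v A + mnl_revenue p v B
    <= mnl_revenue p v (A :|: B) + mnl_revenue p v (A :&: B).
Proof.
move=> v_gt0; wlog le_AB : A B / mnl_revenue p v A <= mnl_revenue p v B.
  move=> wlogH hA hB; case: (leP (mnl_revenue p v A) (mnl_revenue p v B)).
    by move=> h; apply: wlogH.
  by move=> /ltW h; rewrite finset.setUC finset.setIC addrC; apply: wlogH.
move=> hA _; set a := mnl_revenue p v A; set b := mnl_revenue p v B.
pose D := B :\: A.
have eqU : mnl_revenue p v (A :|: B) - a
         = surplus p v a D / total_weight v (A :|: B).
  rewrite mnl_revenueB //; congr (_ / _).
  rewrite /surplus (big_setID A) /= finset.setUK -/(surplus p v a A).
  rewrite surplus_revenue // finset.setDUl finset.setDv finset.set0U.
  by rewrite addrAC subrr add0r.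
have eqI : mnl_revenue p v (A :&: B) - b
         = - surplus p v b D / total_weight v (A :&: B).
  rewrite mnl_revenueB //; congr (_ / _).
  have := surplus_revenue p B v_gt0.
  rewrite -/b {1}/surplus (big_setID A) /= finset.setIC => {2}<-.
  by rewrite opprD addNKr.
have D_le0 : surplus p v a D <= 0.
  rewrite -oppr_ge0 -sumrN sumr_ge0 // => i; rewrite inE => /andP[iA _].
  by rewrite -mulNr opprB mulr_ge0 ?subr_ge0 ?hA // ltW.
have D_le : surplus p v b D <= surplus p v a D.
  by apply: ler_sum => i _; rewrite ler_wpM2r ?lerB // ltW.
have WI := total_weight_gt0 (A :&: B) v_gt0.
have WU := total_weight_gt0 (A :|: B) v_gt0.
have le_W : total_weight v (A :&: B) <= total_weight v (A :|: B).
  apply: le_total_weight => //.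
  exact: fintype.subset_trans (finset.subsetIl _ _) (finset.subsetUl _ _).
suff : surplus p v b D / total_weight v (A :&: B)
       <= surplus p v a D / total_weight v (A :|: B).
  by move: eqU eqI; rewrite mulNr; lra.
apply: (@le_trans _ _ (surplus p v a D / total_weight v (A :&: B))).
  by rewrite ler_wpM2r // invr_ge0 ltW.
by rewrite ler_wnM2l // lef_pV2.
Qed.

(** * Nested families of assortments *)

Definition required (n T : nat) (ell : 'I_n -> nat) (t : 'I_T) : {set 'I_n} :=
  [set i | (t < ell i)%N].

Definition family_update (T : nat) (X : Type) (S : {ffun 'I_T -> X}) (s : 'I_T)
    (A : X) : {ffun 'I_T -> X} :=
  [ffun u => if u == s then A else S u].

(** The term [Phi] is left abstract because this splitting is needed for display
counts, for revenues and for a weighted count of products. *)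
Lemma big_family_update (M : Type) (idx : M) (op : Monoid.com_law idx)
    (T : nat) (X : Type) (Phi : 'I_T -> X -> M)
    (S : {ffun 'I_T -> X}) (s : 'I_T) (A : X) :
  \big[op/idx]_(u < T) Phi u (family_update S s A u)
    = op (Phi s A) (\big[op/idx]_(u < T | u != s) Phi u (S u)).
Proof.
rewrite (bigD1 s) //= ffunE eqxx; congr (op _ _).
by apply: eq_bigr => u /negbTE us; rewrite ffunE us.
Qed.

Lemma big_family_update2 (M : Type) (idx : M) (op : Monoid.com_law idx)
    (T : nat) (X : Type) (Phi : 'I_T -> X -> M)
    (S : {ffun 'I_T -> X}) (s t : 'I_T) (A B : X) :
  s != t ->
  \big[op/idx]_(u < T) Phi u (family_update (family_update S t B) s A u)
    = op (Phi s A) (op (Phi t B)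
        (\big[op/idx]_(u < T | (u != s) && (u != t)) Phi u (S u))).
Proof.
move=> st; rewrite big_family_update (bigD1 t) 1?eq_sym //= ffunE eqxx.
congr (op _ (op _ _)).
by apply: eq_bigr => u /andP[_ /negbTE ut]; rewrite ffunE ut.
Qed.

(** Among the feasible families that earn at least as much as [S0], take one
that maximizes the sum of (T - t) * #|S t|.  The weights T - t are positive,
so no assortment can be extended by a product priced at least at its revenue.
They are strictly decreasing, so uncrossing two periods s < t, with the union
put at s, cannot move any product from t to s: hence S t is contained
in S s. *)
Lemma apv_nested_dominates (R : realType) (n T : nat) (p v : 'I_n -> R)
    (ell : 'I_n -> nat) (S0 : {ffun 'I_T -> {set 'I_n}}) :
  (forall i, 0 < v i) -> apv_feasible ell S0 ->
  exists S : {ffun 'I_T -> {set 'I_n}},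
    [/\ apv_feasible ell S, apv_objective p v S0 <= apv_objective p v S
      & forall s t : 'I_T, (s < t)%N -> S t \subset S s].
Proof.
move=> v_gt0 feas0.
pose P (S : {ffun 'I_T -> {set 'I_n}}) :=
  [forall i, (ell i <= \sum_(t < T) (i \in S t))%N]
    && (apv_objective p v S0 <= apv_objective p v S).
pose potential (S : {ffun 'I_T -> {set 'I_n}}) :=
  (\sum_(t < T) (T - t) * #|S t|)%N.
have P0 : P S0 by rewrite /P lexx andbT; apply/forallP.
case: (arg_maxnP potential P0) => S /andP[/forallP feasS objS] maxS.
(* otherwise adding i to period s would increase the potential *)
have priced (s : 'I_T) (i : 'I_n) :
    i \notin S s -> p i <= mnl_revenue p v (S s).
  move=> iS; case: leP => // /ltW le_p.
  have := maxS (family_update S s (i |: S s)).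
  have -> : P (family_update S s (i |: S s)).
    apply/andP; split.
      apply/forallP => j; apply: leq_trans (feasS j) _.
      rewrite (big_family_update _ (fun _ (A : {set 'I_n}) => (j \in A) : nat)).
      rewrite (bigD1 s) //= leq_add2r inE.
      by case: (j \in S s); rewrite ?orbT.
    apply: le_trans objS _; rewrite /apv_objective.
    rewrite (big_family_update _ (fun _ (A : {set 'I_n}) => mnl_revenue p v A)).
    by rewrite (bigD1 s) //= lerD2r mnl_revenue_add.
  rewrite /potential.
  rewrite (big_family_update _ (fun u (A : {set 'I_n}) => (T - u) * #|A|)%N).
  rewrite (bigD1 s) //= cardsU1 iS => /(_ isT).
  by rewrite /geq /= leq_add2r leq_pmul2l ?subn_gt0 // ltnn.
exists S; split => // s t lt_st.
have st : s != t by apply: contraTneq lt_st => ->; rewrite ltnn.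
pose S' := family_update (family_update S t (S s :&: S t)) s (S s :|: S t).
have PS' : P S'.
  apply/andP; split.
    apply/forallP => j; apply: leq_trans (feasS j) _.
    rewrite (big_family_update2 _
      (fun _ (A : {set 'I_n}) => (j \in A) : nat)) //.
    rewrite (bigD1 s) // (bigD1 t) 1?eq_sym //= !addnA leq_add2r !inE.
    by case: (j \in S s); case: (j \in S t).
  apply: le_trans objS _; rewrite /apv_objective.
  rewrite (big_family_update2 _
    (fun _ (A : {set 'I_n}) => mnl_revenue p v A)) //.
  rewrite (bigD1 s) // (bigD1 t) 1?eq_sym //= !addrA lerD2r.
  by apply: mnl_revenue_uncross => // i; apply: priced.
have := maxS _ PS'; rewrite /potential.
rewrite (big_family_update2 _ (fun u (A : {set 'I_n}) => (T - u) * #|A|)%N) //.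
rewrite (bigD1 s) // (bigD1 t) 1?eq_sym //= /geq /= => le_pot.
rewrite -finset.setD_eq0 -cards_eq0.
have cI := cardsID (S s) (S t); have cU := cardsUI (S s) (S t).
rewrite finset.setIC in cI; have := ltn_ord t; move: le_pot cI cU.
set U := #|S s :|: S t|; set I := #|S s :&: S t|; set D := #|_ :\: _|.
set rest := (\sum_(_ < _ | _) _)%N => le_pot cI cU tT.
have eU : U = (#|S s| + D)%N by lia.
have eT : (T - s = (T - t) + (t - s))%N by lia.
(* uncrossing moves D products from period t to period s, each of which adds
   t - s to the potential, and the potential is already maximal *)
have : ((t - s) * D <= 0)%N.
  move: le_pot; rewrite eU -cI eT; clearbody D I rest.
  by move: (T - t)%N (t - s)%N #|S s| => x y a; clear; nia.
by rewrite leqn0 muln_eq0 subn_eq0 leqNgt lt_st.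
Qed.

Lemma sum_ltn_ord (T m : nat) : (m <= T)%N -> (\sum_(u < T) (u < m) = m)%N.
Proof.
move=> le_mT; have := @big_ord_widen nat 0%N addn m T (fun=> 1%N) le_mT.
rewrite sum1_card card_ord big_mkcond => {2}->.
by apply: eq_bigr => u _; case: ltnP.
Qed.

Lemma nested_required (n T : nat) (ell : 'I_n -> nat)
    (S : {ffun 'I_T -> {set 'I_n}}) :
  apv_feasible ell S ->
  (forall s t : 'I_T, (s < t)%N -> S t \subset S s) ->
  forall t, required ell t \subset S t.
Proof.
move=> feas nested t; apply/fintype.subsetP => i; rewrite inE => lt_t.
apply: contraTT lt_t => iS; rewrite -leqNgt; apply: leq_trans (feas i) _.
rewrite -[leqRHS](sum_ltn_ord (ltnW (ltn_ord t))).
apply: leq_sum => u _; case: (ltnP u t) => [|le_tu]; first by case: (i \in _).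
rewrite leqn0 eqb0; move: le_tu; rewrite leq_eqVlt => /orP[/eqP/val_inj<- //|].
by move=> /nested /fintype.subsetP sub; apply: contra iS; apply: sub.
Qed.

Lemma required_feasible (n T : nat) (ell : 'I_n -> nat)
    (S : {ffun 'I_T -> {set 'I_n}}) :
  (forall i, (ell i <= T)%N) ->
  (forall t, required ell t \subset S t) -> apv_feasible ell S.
Proof.
move=> ell_le sub i; rewrite -[leqLHS](sum_ltn_ord (ell_le i)).
apply: leq_sum => u _; case: ltnP => // lt_u.
by rewrite (fintype.subsetP (sub u)) // inE.
Qed.

(** * One column of the linear program *)

(** This is the counterpart of [surplus_revenue] for a fractional assortment:
the requirement that a column sums to 1 does for its value what the
denominator does for the revenue of a set. *)
Lemma column_excess (R : realType) (n : nat) (p y : 'I_n -> R) (a0 : R) :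
  a0 + \sum_i y i = 1 ->
  \sum_i (p i - \sum_j p j * y j) * y i = (\sum_j p j * y j) * a0.
Proof.
move=> sum1; set z := \sum_j p j * y j.
under eq_bigr do rewrite mulrBl.
rewrite sumrB -mulr_sumr -/z.
have -> : \sum_i y i = 1 - a0 by rewrite -sum1 addrC addKr.
by ring.
Qed.

(** Given the value z of a column, this is the best set containing [M] for the
linearized objective, the sum of (p_i - z) v_i. *)
Definition threshold (R : realType) (n : nat) (p : 'I_n -> R)
    (M : {set 'I_n}) (z : R) : {set 'I_n} := M :|: [set i | z <= p i].

(** The left-hand side is linear in [y i], so it is largest at an end of the
range from 0 to [v i * a0], and the sign of p i - z, which decides membership
in the threshold set, tells which end.  A product of [M] is at the upper
end from the start. *)
Lemma threshold_gain (R : realType) (n : nat) (p v y : 'I_n -> R) (a0 z : R)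
    (M : {set 'I_n}) (i : 'I_n) :
  (forall i, 0 <= y i <= v i * a0) -> (forall i, i \in M -> y i = v i * a0) ->
  (p i - z) * y i <= if i \in threshold p M z then (p i - z) * v i * a0 else 0.
Proof.
move=> yb yM; have /andP[y_ge0 y_le] := yb i; rewrite !inE -mulrA.
case: (boolP (i \in M)) => /= [/yM -> //|_].
case: (leP z (p i)) => [le_zp|lt_pz]; first by rewrite ler_wpM2l ?subr_ge0.
by rewrite nmulr_rle0 ?subr_lt0.
Qed.

(** Summing [threshold_gain] over the products and dividing by [a0] gives
the linearized form of the claim. *)
Lemma threshold_revenue (R : realType) (n : nat) (p v y : 'I_n -> R) (a0 : R)
    (M : {set 'I_n}) :
  (forall i, 0 < v i) -> 0 < a0 ->
  (forall i, 0 <= y i <= v i * a0) -> (forall i, i \in M -> y i = v i * a0) ->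
  a0 + \sum_i y i = 1 ->
  \sum_i p i * y i <= mnl_revenue p v (threshold p M (\sum_i p i * y i)).
Proof.
move=> v_gt0 a0_gt0 yb yM sum1; set z := \sum_i p i * y i.
rewrite le_mnl_revenue // -(ler_pM2r a0_gt0) -column_excess // -/z.
rewrite /surplus mulr_suml [leRHS]big_mkcond.
by apply: ler_sum => i _; apply: threshold_gain.
Qed.

(** As the threshold set earns no more than z, the sum of the inequalities of
[threshold_gain] is an equality, so each of them is one.  Outside the threshold
set this says (p i - z) * y i = 0 with p i < z, so y i = 0.  The support
therefore only loses products whose term (p i - z) v i is zero. *)
Lemma support_revenue (R : realType) (n : nat) (p v y : 'I_n -> R) (a0 : R)
    (M : {set 'I_n}) :
  (forall i, 0 < v i) -> 0 < a0 ->
  (forall i, 0 <= y i <= v i * a0) -> (forall i, i \in M -> y i = v i * a0) ->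
  a0 + \sum_i y i = 1 ->
  (forall S : {set 'I_n}, M \subset S ->
     mnl_revenue p v S <= \sum_i p i * y i) ->
  \sum_i p i * y i <= mnl_revenue p v [set i | 0 < y i].
Proof.
move=> v_gt0 a0_gt0 yb yM sum1; set z := \sum_i p i * y i => maxz.
have excess := column_excess p sum1; rewrite -/z in excess.
have gain i := @threshold_gain R n p v y a0 z M i yb yM.
set best := threshold p M z in gain.
have rev_best : mnl_revenue p v best = z.
  apply/le_anti; rewrite maxz ?finset.subsetUl //=.
  by rewrite (threshold_revenue _ v_gt0 a0_gt0).
have tight i : (p i - z) * y i = if i \in best then (p i - z) * v i * a0 else 0.
  apply/esym/eqP; rewrite -subr_eq0; apply/eqP; move: i (erefl true).
  apply: psumr_eq0P => [i _|]; first by rewrite subr_ge0.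
  rewrite sumrB excess -big_mkcond -mulr_suml.
  rewrite -/(surplus p v z best) -{1}rev_best surplus_revenue //.
  by rewrite rev_best subrr.
rewrite le_mnl_revenue // -(ler_pM2r a0_gt0) -excess.
rewrite /surplus mulr_suml [leRHS]big_mkcond; apply: ler_sum => i _.
have /andP[y_ge0 y_le] := yb i; rewrite inE.
case: ltP => [y_gt0|y_le0]; last first.
  have -> : y i = 0 by apply/le_anti; rewrite y_le0 y_ge0.
  by rewrite mulr0.
have := tight i; case: ifP => [_ -> //|/negbT].
rewrite /best !inE negb_or -ltNge => /andP[_ lt_pz] /eqP.
by rewrite mulf_eq0 subr_eq0 (lt_eqF lt_pz) (gt_eqF y_gt0).
Qed.

(** * The two programs *)

Lemma opt_valueE (R : realType) (X : Type) (F : set X) (f : X -> R) (x : X) :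
  is_optimal F f x -> opt_value F f = f x.
Proof.
move=> [Fx max_x]; apply/le_anti/andP; split.
  apply: ge_sup; first by exists (f x), x.
  by move=> _ [y Fy <-]; apply: max_x.
apply: ub_le_sup; last by exists x.
by exists (f x) => _ [y Fy <-]; apply: max_x.
Qed.

(** The positivity of the no-purchase entry is not among the constraints: were
it nonpositive, the upper bounds would make every entry of the column
nonpositive, and the column could not sum to 1. *)
Lemma lp_columnP (R : realType) (n T : nat) (v : 'I_n -> R)
    (ell : 'I_n -> nat) (alpha : 'M[R]_(n.+1, T)) (t : 'I_T) :
  (forall i, 0 < v i) -> lp_feasible v ell alpha ->
  [/\ 0 < alpha ord0 t,
      forall i, 0 <= alpha (lift ord0 i) t <= v i * alpha ord0 t,
      forall i, i \in required ell t ->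
        alpha (lift ord0 i) t = v i * alpha ord0 t
    & alpha ord0 t + \sum_i alpha (lift ord0 i) t = 1].
Proof.
move=> v_gt0 [sum1 eq_req le_free].
have {}sum1 : alpha ord0 t + \sum_i alpha (lift ord0 i) t = 1.
  by rewrite -(sum1 t) big_ord_recl.
have eq_req' i : i \in required ell t ->
    alpha (lift ord0 i) t = v i * alpha ord0 t.
  rewrite inE => /eq_req <-; rewrite mulrC divfK //.
  by rewrite gt_eqF.
have le_cap i : alpha (lift ord0 i) t <= v i * alpha ord0 t.
  case: (ltnP t (ell i)) => [lt_t|/le_free /andP[_]].
    by rewrite eq_req' // inE.
  by rewrite ler_pdivrMr // mulrC.
have a0_gt0 : 0 < alpha ord0 t.
  rewrite ltNge; apply/negP => a0_le0; have := @ltr01 R.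
  rewrite ltNge -sum1 => /negP; apply.
  rewrite -[leRHS]addr0 lerD // -oppr_ge0 -sumrN sumr_ge0 // => i _.
  rewrite oppr_ge0; apply: le_trans (le_cap i) _.
  by rewrite pmulr_rle0.
split=> // i; rewrite le_cap andbT.
case: (ltnP t (ell i)) => [lt_t|/le_free /andP[+ _]].
  by rewrite eq_req' ?inE // mulr_ge0 // ltW.
by rewrite pmulr_lge0 // invr_gt0.
Qed.

(** Column t lists the MNL choice probabilities when [S t] is offered. *)
Definition lp_of_sets (R : realType) (n T : nat) (v : 'I_n -> R)
    (S : {ffun 'I_T -> {set 'I_n}}) : 'M[R]_(n.+1, T) :=
  \matrix_(k, t) ((if unlift ord0 k is Some i then
                     if i \in S t then v i else 0
                   else 1) / total_weight v (S t)).

Lemma lp_of_sets0 (R : realType) (n T : nat) (v : 'I_n -> R)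
    (S : {ffun 'I_T -> {set 'I_n}}) (t : 'I_T) :
  lp_of_sets v S ord0 t = 1 / total_weight v (S t).
Proof. by rewrite mxE unlift_none. Qed.

Lemma lp_of_sets_lift (R : realType) (n T : nat) (v : 'I_n -> R)
    (S : {ffun 'I_T -> {set 'I_n}}) (i : 'I_n) (t : 'I_T) :
  lp_of_sets v S (lift ord0 i) t
    = (if i \in S t then v i else 0) / total_weight v (S t).
Proof. by rewrite mxE liftK. Qed.

Lemma lp_of_sets_feasible (R : realType) (n T : nat) (v : 'I_n -> R)
    (ell : 'I_n -> nat) (S : {ffun 'I_T -> {set 'I_n}}) :
  (forall i, 0 < v i) -> (forall t, required ell t \subset S t) ->
  lp_feasible v ell (lp_of_sets v S).
Proof.
move=> v_gt0 sub.
have W0 t := total_weight_gt0 (S t) v_gt0.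
split=> [t|i t lt_t|i t _].
- rewrite big_ord_recl lp_of_sets0.
  under eq_bigr do rewrite lp_of_sets_lift.
  rewrite -mulr_suml -big_mkcond -mulrDl -/(total_weight v (S t)).
  by rewrite divff // gt_eqF.
- rewrite lp_of_sets_lift lp_of_sets0 (fintype.subsetP (sub t)) ?inE //.
  by rewrite mulrAC divff ?gt_eqF.
- rewrite lp_of_sets_lift lp_of_sets0; case: ifP => _.
    by rewrite mulrAC divff ?gt_eqF // lexx andbT divr_ge0 ?ler01 // ltW.
  by rewrite !mul0r lexx divr_ge0 ?ler01 // ltW.
Qed.

Lemma lp_objectiveE (R : realType) (n T : nat) (p : 'I_n -> R)
    (alpha : 'M[R]_(n.+1, T)) :
  lp_objective p alpha = \sum_t \sum_i p i * alpha (lift ord0 i) t.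
Proof.
rewrite exchange_big /lp_objective; apply: eq_bigr => i _.
by rewrite mulr_sumr.
Qed.

Lemma lp_of_sets_objective (R : realType) (n T : nat) (p v : 'I_n -> R)
    (S : {ffun 'I_T -> {set 'I_n}}) :
  lp_objective p (lp_of_sets v S) = apv_objective p v S.
Proof.
rewrite lp_objectiveE; apply: eq_bigr => t _.
rewrite /mnl_revenue -/(total_weight v (S t)) mulr_suml [RHS]big_mkcond.
apply: eq_bigr => i _; rewrite lp_of_sets_lift mulrA.
by case: ifP => // _; rewrite mulr0 mul0r.
Qed.

Definition best_sets (R : realType) (n T : nat) (p v : 'I_n -> R)
    (ell : 'I_n -> nat) : {ffun 'I_T -> {set 'I_n}} :=
  [ffun t => [arg max_(S > required ell t | required ell t \subset S)
                mnl_revenue p v S]%O].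

Lemma best_setsP (R : realType) (n T : nat) (p v : 'I_n -> R)
    (ell : 'I_n -> nat) (t : 'I_T) :
  required ell t \subset best_sets T p v ell t /\
  forall S : {set 'I_n}, required ell t \subset S ->
    mnl_revenue p v S <= mnl_revenue p v (best_sets T p v ell t).
Proof.
rewrite ffunE.
case: (@arg_maxP _ _ _ _ (fun S : {set 'I_n} => required ell t \subset S)
  (mnl_revenue p v) (fintype.subxx _)) => S subS maxS.
by split.
Qed.

Theorem theorem3p9 (R : realType) (n T : nat) (p v : 'I_n -> R)
    (ell : 'I_n -> nat)
    (p_sorted : forall i j : 'I_n, (i <= j)%N -> p j <= p i)
    (p_ge0 : forall i : 'I_n, 0 <= p i)
    (v_gt0 : forall i : 'I_n, 0 < v i)
    (T_ge1 : (1 <= T)%N)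
    (ell_le : forall i : 'I_n, (ell i <= T)%N) :
  [/\ exists S : {ffun 'I_T -> {set 'I_n}},
        is_optimal (apv_feasible ell) (apv_objective p v) S,
      exists alpha : 'M[R]_(n.+1, T),
        is_optimal (lp_feasible v ell) (lp_objective p) alpha,
      opt_value (@lp_feasible R n T v ell) (lp_objective p)
        = opt_value (@apv_feasible n T ell) (apv_objective p v)
    & forall alpha : 'M[R]_(n.+1, T),
        is_optimal (lp_feasible v ell) (lp_objective p) alpha ->
        is_optimal (apv_feasible ell) (apv_objective p v) (lp_support alpha)].
Proof.
pose best := best_sets T p v ell.
have best_sub t : required ell t \subset best t.
  by case: (best_setsP p v ell t).
have best_max t (S : {set 'I_n}) : required ell t \subset S ->
    mnl_revenue p v S <= mnl_revenue p v (best t).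
  by case: (best_setsP p v ell t) => _; apply.
have column_le alpha (t : 'I_T) : lp_feasible v ell alpha ->
    \sum_i p i * alpha (lift ord0 i) t <= mnl_revenue p v (best t).
  move=> /(lp_columnP t v_gt0) [a0_gt0 cap req sum1].
  apply: le_trans (threshold_revenue p v_gt0 a0_gt0 cap req sum1) _.
  by apply: best_max; apply: finset.subsetUl.
have apv_best : is_optimal (@apv_feasible n T ell) (apv_objective p v) best.
  split=> [|S0 feas0]; first exact: required_feasible.
  have [S [feas le_obj nested]] := apv_nested_dominates p v_gt0 feas0.
  apply: le_trans le_obj _; apply: ler_sum => t _.
  exact: best_max (nested_required feas nested t).
have lp_best : is_optimal (@lp_feasible R n T v ell) (lp_objective p)
    (lp_of_sets v best).
  split=> [|alpha feas]; first exact: lp_of_sets_feasible.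
  rewrite lp_of_sets_objective lp_objectiveE.
  by apply: ler_sum => t _; apply: column_le.
split; [by exists best | by exists (lp_of_sets v best) | |].
  by rewrite (opt_valueE lp_best) (opt_valueE apv_best) lp_of_sets_objective.
move=> alpha [feas max_alpha].
(* each column is worth at most its G_t and the totals agree *)
have column_eq t :
    \sum_i p i * alpha (lift ord0 i) t = mnl_revenue p v (best t).
  apply/esym/eqP; rewrite -subr_eq0; apply/eqP; move: t (erefl true).
  apply: psumr_eq0P => [t _|]; first by rewrite subr_ge0 column_le.
  apply/le_anti; rewrite sumr_ge0 ?andbT => [|t _]; last first.
    by rewrite subr_ge0 column_le.
  rewrite sumrB subr_le0 -lp_objectiveE -/(apv_objective p v best).
  by rewrite -lp_of_sets_objective max_alpha //; apply: lp_best.1.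
split=> [|S feasS].
  apply: required_feasible => // t; apply/fintype.subsetP => i req_i.
  have [a0_gt0 _ /(_ i req_i) eq_i _] := lp_columnP t v_gt0 feas.
  by rewrite ffunE inE eq_i mulr_gt0.
apply: le_trans (apv_best.2 S feasS) _; apply: ler_sum => t _.
have [a0_gt0 cap req sum1] := lp_columnP t v_gt0 feas.
rewrite -column_eq ffunE; apply: (support_revenue v_gt0 a0_gt0 cap req sum1).
by move=> S' subS'; rewrite column_eq; apply: best_max.
Qed.
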